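(* Let $H$ be a graph and let $t$ be a nonnegative integer. If $\operatorname{cfan}(H)>t$, then there exists a graph $G$ whose $t$-core is $H$ such that $\operatorname{Fan}(G)>\Delta(G)+t$.
   Context: A graph may have parallel edges but no loops. For a graph $J$ and vertices $x,y$, $\mu_J(x,y)$ is the number of edges of $J$ joining $x,y$; $\mu_J(v)=\max_u\mu_J(v,u)$; $d_J(v)$ is the degree of $v$ in $J$ counting parallel edges; $N_J(x)$ is the set of neighbours of $x$ in $J$; $\Delta(G)$ is the maximum degree. A subgraph may contain only some of the parallel copies of an edge. The $t$-core of $G$ is the subgraph of $G$ induced by the vertices $v$ with $d_G(v)+\mu_G(v)>\Delta(G)+t$. Fan number: for $J\subseteq G$ and $xy\in E(J)$, the fan-degree $\deg_J(x,y)$ is the smallest nonnegative integer $k$ such that either (i) $d_J(x)+d_J(y)-\mu_J(x,y)\leq k$, or (ii) $\sum_{z\in Z}(d_J(z)+\mu_J(x,z)-k)\leq 1$ for all $Z\subseteq N_J(x)$ with $y\in Z$ and $|Z|\geq 2$. Then $\operatorname{fan}(G)=\max_{J\subseteq G,\,E(J)\neq\emptyset}\min\{\deg_J(x,y): xy\in E(J)\}$ (and $0$ if $G$ is edgeless), and $\operatorname{Fan}(G)=\max\{\Delta(G),\operatorname{fan}(G)\}$. Cfan number: for a graph $H$, a subgraph $K\subseteq H$ and an ordered pair $(x,y)$ with $xy\in E(K)$, $\operatorname{cdeg}_{H,K}(x,y)$ is the smallest nonnegative integer $l$ such that for all $Z\subseteq N_K(x)$ with $y\in Z$, $\sum_{z\in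 Z}(d_K(z)-d_H(z)+\mu_K(x,z)-l)\leq 1$. Then $\operatorname{cfan}(H)=\max_{K\subseteq H,\,E(K)\neq\emptyset}\min\{\operatorname{cdeg}_{H,K}(x,y): xy\in E(K)\}$, with $\operatorname{cfan}(H)=0$ if $H$ is edgeless. *)

(* Defs.v *)
From HB Require Import structures.
From mathcomp Require Import all_boot all_order all_algebra.

Set Implicit Arguments.
Unset Strict Implicit.
Unset Printing Implicit Defensive.

Import Order.TTheory GRing.Theory Num.Theory.

(* Finite graphs, with parallel edges and without loops: each edge has exactly
   two ends. *)
Record mgraph := MGraph {
  vert : finType;
  edge : finType;
  ends : edge -> {set vert};
  card_ends : forall e, #|ends e| = 2 }.

(* Edges are individual objects, so that a subgraph may contain only some of
   the parallel edges joining two vertices. *)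
Record subgraph (G : mgraph) := Subgraph {
  sub_sets : {set vert G} * {set edge G};
  _ : [forall e in sub_sets.2, ends e \subset sub_sets.1] }.

HB.instance Definition _ (G : mgraph) := [isSub for @sub_sets G].
HB.instance Definition _ (G : mgraph) := [Finite of subgraph G by <:].

Definition verts (G : mgraph) (J : subgraph G) : {set vert G} :=
  (sub_sets J).1.
Definition edges (G : mgraph) (J : subgraph G) : {set edge G} :=
  (sub_sets J).2.

Lemma induced_proof (G : mgraph) (A : {set vert G}) :
  [forall e in [set e | ends e \subset A], ends e \subset A].
Proof. by apply/forall_inP => e; rewrite inE. Qed.

Definition induced (G : mgraph) (A : {set vert G}) : subgraph G :=
  @Subgraph G (A, [set e | ends e \subset A]) (induced_proof A).

Definition whole (G : mgraph) : subgraph G := induced [set: vert G].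

Section Degrees.
Variables (G : mgraph) (J : subgraph G).
Implicit Types x y v : vert G.

Definition mult x y : nat := #|[set e in edges J | ends e == [set x; y]]|.
Definition max_mult v : nat := \max_(u in verts J) mult v u.
Definition degree v : nat := #|[set e in edges J | v \in ends e]|.
Definition neighbours x : {set vert G} := [set y | 0 < mult x y].
Definition max_degree : nat := \max_(v in verts J) degree v.

End Degrees.

Definition Delta (G : mgraph) : nat := max_degree (whole G).

Definition core (G : mgraph) (t : nat) : subgraph G :=
  induced [set v | Delta G + t < degree (whole G) v + max_mult (whole G) v].

Definition isomorphic_to (H G : mgraph) (J : subgraph G) : Prop :=
  exists (f : vert H -> vert G) (g : edge H -> edge G),
    [/\ injective f, injective g, f @: [set: vert H] = verts J,
        g @: [set: edge H] = edges J
      & forall e, ends (g e) = f @: ends e].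

(* The minimum of a nonempty list (0 for the empty list). *)
Definition min_seq (s : seq nat) : nat := \big[minn/head 0 s]_(n <- s) n.

(* The minimum of F x y over the ordered pairs (x, y) with xy an edge of J. *)
Definition min_over_edges (G : mgraph) (J : subgraph G)
    (F : vert G -> vert G -> nat) : nat :=
  min_seq [seq F p.1 p.2 |
            p : vert G * vert G in [pred p | 0 < mult J p.1 p.2]].

Section FanDegree.
Variables (G : mgraph) (J : subgraph G) (x y : vert G).

(* The truncated subtraction is harmless, as mult J x y <= degree J x. *)
Definition fan_bound (k : nat) : bool :=
  (degree J x + degree J y - mult J x y <= k) ||
  [forall Z : {set vert G},
    [&& Z \subset neighbours J x, y \in Z & 2 <= #|Z|] ==>
    (\sum_(z in Z) ((degree J z)%:Z + (mult J x z)%:Z - k%:Z) <= 1)%R].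

Lemma ex_fan_bound : exists k, fan_bound k.
Proof.
by exists (degree J x + degree J y - mult J x y); rewrite /fan_bound leqnn.
Qed.

Definition fan_deg : nat := ex_minn ex_fan_bound.

End FanDegree.

Definition fan (G : mgraph) : nat :=
  \max_(J : subgraph G | edges J != set0) min_over_edges J (fan_deg J).

Definition Fan (G : mgraph) : nat := maxn (Delta G) (fan G).

Section CfanDegree.
Variables (H : mgraph) (K : subgraph H) (x y : vert H).

Definition cfan_bound (l : nat) : bool :=
  [forall Z : {set vert H},
    (Z \subset neighbours K x) && (y \in Z) ==>
    (\sum_(z in Z) ((degree K z)%:Z - (degree (whole H) z)%:Z
                    + (mult K x z)%:Z - l%:Z) <= 1)%R].

Lemma ex_cfan_bound : exists l, cfan_bound l.
Proof.
exists (\max_z (degree K z + mult K x z)).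
apply/forallP => Z; apply/implyP => _.
apply: (@le_trans _ _ 0%R) => //; apply: sumr_le0 => z _.
rewrite subr_le0 addrAC lerBlDr -!PoszD lez_nat.
apply: leq_trans (leq_addr _ _).
exact: (leq_bigmax (F := fun z => degree K z + mult K x z)).
Qed.

Definition cfan_deg : nat := ex_minn ex_cfan_bound.

End CfanDegree.

Definition cfan (H : mgraph) : nat :=
  \max_(K : subgraph H | edges K != set0) min_over_edges K (cfan_deg K).

(* Main.v *)
(* Let [K] witness [cfan H > t], so that at each ordered pair [(x, y)] joined in
   [K] some [Z] has sum at least 2 in the definition of the cfan-degree with
   [l = t].  Take [q] large, put [D = 6 q - t], and attach to each vertex of [H]
   a gadget of three new vertices raising its degree to [D].  Then
   [d_J z - (D + t) = d_K z - d_H z - t] when [J] consists of [K] and of the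
   gadgets at the non-isolated vertices of [K], so the same sets [Z] bound the
   fan-degrees at [x] from below; a gadget vertex [w], for which
   [d_J w + mu_J (x, w) = D + t], can be added to [Z] for free, which ensures
   [|Z| >= 2] and handles the pairs [(x, w)].  For the pairs [(w, _)] the sets
   [{x, w'}] do. *)

Require Import Defs.
From mathcomp Require Import all_boot all_order all_algebra.
From mathcomp Require Import zify.

Set Implicit Arguments.
Unset Strict Implicit.
Unset Printing Implicit Defensive.

Import Order.TTheory GRing.Theory Num.Theory.

(** * Minima over lists and over the edges of a subgraph *)

Lemma leq_min_seq (s : seq nat) (n : nat) : n \in s -> min_seq s <= n.
Proof.
rewrite /min_seq; elim: s (head 0 s) => [|a s IHs] m0 //.
rewrite in_cons big_cons => /predU1P[->|/(IHs m0)]; first exact: geq_minl.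
exact: leq_trans (geq_minr _ _).
Qed.

Lemma min_seq_gt (s : seq nat) (k : nat) :
  s != [::] -> (forall n, n \in s -> k < n) -> k < min_seq s.
Proof.
case: s => // a s _ gt_k; rewrite /min_seq big_seq.
(* The default value of the minimum is the head [a], itself a member of the list, so it exceeds [k]
   as well. *)
elim/big_ind: _ => [|m n km kn|i /gt_k] //; first by rewrite gt_k ?mem_head.
by rewrite leq_min km.
Qed.

Lemma min_over_edges_leq (G : mgraph) (J : subgraph G) F x y :
  0 < mult J x y -> min_over_edges J F <= F x y.
Proof.
by move=> xy; apply/leq_min_seq/imageP; exists (x, y).
Qed.

Lemma min_over_edges_gt (G : mgraph) (J : subgraph G) F k :
  (exists x y, 0 < mult J x y) ->
  (forall x y, 0 < mult J x y -> k < F x y) -> k < min_over_edges J F.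
Proof.
move=> [x [y xy]] gt_k; apply: min_seq_gt => [|n /imageP[[u v] /= uv ->]].
  rewrite -size_eq0 size_image -lt0n; apply/card_gt0P.
  by exists (x, y).
exact: gt_k.
Qed.

(** * Multiplicities and bounds on fan-degrees and cfan-degrees *)

Section Subgraphs.
Variables (G : mgraph) (J : subgraph G).
Implicit Types x y : vert G.

Lemma mem_whole (e : edge G) : e \in edges (whole G).
Proof. by rewrite inE subsetT. Qed.

Lemma multC x y : mult J x y = mult J y x.
Proof. by rewrite /mult setUC. Qed.

Lemma mult_gt0_neq x y : 0 < mult J x y -> x != y.
Proof.
case/card_gt0P=> e; rewrite inE => /andP[_ /eqP exy].
by have := card_ends e; rewrite exy cards2; case: eqVneq.
Qed.

Lemma exists_mult_gt0 : edges J != set0 -> exists x y, 0 < mult J x y.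
Proof.
case/set0Pn => e eJ; have /eqP/cards2P[x [y [_ exy]]] := card_ends e.
by exists x, y; apply/card_gt0P; exists e; rewrite inE eJ exy eqxx.
Qed.

Lemma mult_gt0_edges x y : 0 < mult J x y -> edges J != set0.
Proof.
by case/card_gt0P=> e; rewrite inE => /andP[eJ _]; apply/set0Pn; exists e.
Qed.

Lemma mult_leq_card_edge x y : mult J x y <= #|edge G|.
Proof. exact: max_card. Qed.

Lemma degree_leq_card_edge x : degree J x <= #|edge G|.
Proof. exact: max_card. Qed.

(** Both alternatives of [fan_bound] persist when the bound grows, so their failure at [k] rules out
    every value up to [k]. *)
Lemma fan_deg_gt x y (k : nat) (Z : {set vert G}) :
  k < degree J x + degree J y - mult J x y ->
  Z \subset neighbours J x -> y \in Z -> 1 < #|Z| ->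
  (2 <= \sum_(z in Z) ((degree J z)%:Z + (mult J x z)%:Z - k%:Z))%R ->
  k < fan_deg J x y.
Proof.
move=> ltk sZ yZ Z2 sumZ; rewrite /fan_deg; case: ex_minnP => l Pl _.
rewrite ltnNge; apply/negP => lk; case/orP: Pl => [|/forallP/(_ Z)].
  by move/(leq_trans ltk); rewrite ltnNge lk.
rewrite sZ yZ Z2 /= => sumZl.
suff : (2 <= (1 : int))%R by [].
apply: le_trans sumZ _; apply: le_trans sumZl.
by apply: ler_sum => z _; rewrite lerD2l lerN2 lez_nat.
Qed.

Lemma cfan_deg_gt x y (l : nat) :
  l < cfan_deg J x y ->
  exists Z : {set vert G}, [/\ Z \subset neighbours J x, y \in Z &
    (2 <= \sum_(z in Z) ((degree J z)%:Z - (degree (whole G) z)%:Z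
                         + (mult J x z)%:Z - l%:Z))%R].
Proof.
rewrite /cfan_deg; case: ex_minnP => m _ minm ltlm.
have /forallPn[Z] : ~~ cfan_bound J x y l.
  by apply: contraTN ltlm => /minm; rewrite -leqNgt.
rewrite negb_imply => /andP[/andP[sZ yZ]]; rewrite -ltNge => sumZ.
by exists Z.
Qed.

End Subgraphs.

Lemma cfan_gt (H : mgraph) (t : nat) :
  t < cfan H -> exists K : subgraph H, edges K != set0 /\
    (forall x y, 0 < mult K x y -> t < cfan_deg K x y).
Proof.
move=> tH; suff /existsP[K /andP[K0 ltK]] :
    [exists K : subgraph H, (edges K != set0) &&
       (t < min_over_edges K (cfan_deg K))].
  exists K; split=> // x y xy.
  exact: leq_trans ltK (min_over_edges_leq _ xy).
apply: contraLR tH => /existsPn noK; rewrite -leqNgt.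
by apply/bigmax_leqP => K K0; rewrite leqNgt; have := noK K; rewrite K0.
Qed.

(** * Counting edges prescribed by multiplicities *)

(** The elements of ['I_(g s)] are parallel edges in the slot [s]; a property that ignores the copy
    counts the slot [g s] times. *)
Lemma card_sum_tagged (E S : finType) (g : S -> nat)
    (P : pred (E + {s : S & 'I_(g s)})) (Q : pred S) :
    (forall e, P (inr e) = Q (tag e)) ->
  #|[set e | P e]| = #|[set e | P (inl e)]| + \sum_s g s * Q s.
Proof.
move=> PQ; rewrite -!sum1_card big_sumType /=; congr (_ + _).
  by apply: eq_bigl => e; rewrite !inE.
rewrite big_mkcond /=.
transitivity (\sum_(e : {s : S & 'I_(g s)}) (Q (tag e) : nat)).
  by apply: eq_bigr => e _; rewrite inE PQ; case: (Q _).
rewrite -(@sig_big_dep _ _ _ S (fun s => 'I_(g s)) predT (fun _ => predT)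
  (fun s _ => (Q s : nat))) /=.
by apply: eq_bigr => s _; rewrite sum_nat_const card_ord.
Qed.

Section UpperTriangle.
Variables (I : finType) (w : I -> I -> nat).
Hypotheses (wC : forall i j, w i j = w j i) (w0 : forall i, w i i = 0).

(** Using [w] on all ordered pairs would create every edge twice; ordering by rank keeps one slot
    per unordered pair. *)
Definition upper (i j : I) : nat :=
  if enum_rank i < enum_rank j then w i j else 0.

Lemma upper_eq0 i : upper i i = 0.
Proof. by rewrite /upper ltnn. Qed.

Lemma upperD i j : upper i j + upper j i = w i j.
Proof.
rewrite /upper; case: ltngtP => [_|_|/val_inj/enum_rank_inj->].
- exact: addn0.
- exact: wC.
- by rewrite w0.
Qed.

Lemma sum_upper_incident k :
  \sum_i \sum_j upper i j * ((k == i) || (k == j)) = \sum_j w k j.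
Proof.
(* The two incidences overlap only for [i = j], where [upper] vanishes, so the disjunction becomes a
   sum. *)
transitivity (\sum_i \sum_j (upper i j * (k == i) + upper i j * (k == j))).
  apply: eq_bigr => i _; apply: eq_bigr => j _; rewrite -mulnDr.
  by have [->|_] := eqVneq k i; have [<-|_] := eqVneq _ j; rewrite ?upper_eq0.
under eq_bigr => i _ do rewrite big_split /=.
rewrite big_split /= [X in X + _]exchange_big -big_split /=.
apply: eq_bigr => i _; rewrite -upperD.
congr (_ + _); rewrite (bigD1 k) //= eqxx muln1 big1 ?addn0 // => j /negPf jk.
  by rewrite eq_sym jk muln0.
by rewrite eq_sym jk muln0.
Qed.

Lemma sum_upper_pair k l :
  \sum_i \sum_j upper i j * ([set i; j] == [set k; l]) = w k l.
Proof.
wlog kl : k l / enum_rank k <= enum_rank l.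
  move=> IH; case/orP: (leq_total (enum_rank k) (enum_rank l)) => /IH // IHkl.
  by rewrite wC -IHkl setUC.
(* Where [upper] is nonzero the ranks increase, so equality of the unordered pairs forces equality
   of the ordered ones. *)
transitivity (\sum_i \sum_j upper i j * ((i == k) && (j == l))).
  apply: eq_bigr => i _; apply: eq_bigr => j _; rewrite /upper.
  case: ifP => // ij; congr (_ * nat_of_bool _); apply/eqP/andP => [eq_ij|[]].
    have : i \in [set k; l] by rewrite -eq_ij set21.
    have : j \in [set k; l] by rewrite -eq_ij set22.
    have : k \in [set i; j] by rewrite eq_ij set21.
    have : l \in [set i; j] by rewrite eq_ij set22.
    rewrite !inE; do 4![case/orP => /eqP ?]; subst; rewrite ?eqxx //;
      by move: ij kl; rewrite ?ltnn // ltnNge => /negPf->.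
  by move=> /eqP-> /eqP->.
rewrite (bigD1 k) //= [X in _ + X]big1 => [|i /negPf ik]; last first.
  by apply: big1 => j _; rewrite ik muln0.
rewrite addn0 (bigD1 l) //= !eqxx muln1 big1 => [|j /negPf jl]; last first.
  by rewrite jl muln0.
rewrite addn0 /upper; case: ltnP => // lk.
have /val_inj/enum_rank_inj-> : enum_rank k = enum_rank l :> nat.
  by apply/eqP; rewrite eqn_leq kl.
by rewrite w0.
Qed.

End UpperTriangle.

(** * Attaching a gadget at every vertex *)

Section Attach.
Variables (H : mgraph) (I : finType) (i0 : I).
Variable w : vert H -> I -> I -> nat.
Hypotheses (wC : forall x i j, w x i j = w x j i)
           (w0 : forall x i, w x i i = 0).

Definition slot_weight (s : vert H * (I * I)) : nat :=
  upper (w s.1) s.2.1 s.2.2.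

Definition attach_edge : finType :=
  (edge H + {s : vert H * (I * I) & 'I_(slot_weight s)})%type.

Definition base (x : vert H) : vert H * I := (x, i0).

Lemma base_inj : injective base.
Proof. by move=> x y []. Qed.

Definition slot_ends (s : vert H * (I * I)) : {set vert H * I} :=
  [set (s.1, s.2.1); (s.1, s.2.2)].

Definition attach_ends (e : attach_edge) : {set vert H * I} :=
  match e with
  | inl e => base @: ends e
  | inr e => slot_ends (tag e)
  end.

Lemma card_attach_ends e : #|attach_ends e| = 2.
Proof.
case: e => [e|[[x [i j]] /= k]].
  by rewrite card_imset ?card_ends //; exact: base_inj.
(* A slot with equal ends has weight 0 and hence carries no edge. *)
rewrite cards2; have [[ij]|//] := eqVneq (x, i) (x, j).
by case: k; rewrite /slot_weight /= ij upper_eq0.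
Qed.

(* A copy of the index set [I] hangs at each vertex [x] of [H], with [x] itself
   at the index [i0], and with [w x i j] parallel edges joining the copies of
   [i] and [j]. *)
Definition attach : mgraph := MGraph card_attach_ends.

Definition attach_edges (K : {set edge H}) (A : {set vert H}) :
    {set edge attach} :=
  [set e : attach_edge | match e with
                         | inl e => e \in K
                         | inr e => (tag e).1 \in A
                         end].

Lemma attach_sub_proof K A : [forall e in attach_edges K A,
  ends e \subset [set: vert attach]].
Proof. by apply/forall_inP => e _; apply: subsetT. Qed.

Definition attach_sub (K : subgraph H) (A : {set vert H}) : subgraph attach :=
  @Subgraph attach ([set: vert attach], attach_edges (edges K) A)
    (attach_sub_proof (edges K) A).

(** Degrees and multiplicities depend on the edge set only, so this reduces those of the whole graph
    to those of [attach_sub]. *)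
Lemma edges_attach_whole :
  edges (whole attach) = edges (attach_sub (whole H) setT).
Proof.
by apply/setP => -[e|e]; rewrite mem_whole inE ?mem_whole ?inE.
Qed.

Lemma sum_slots x (a : bool) (q : I -> I -> bool)
    (Q : pred (vert H * (I * I))) :
  (forall y i j, Q (y, (i, j)) = [&& y == x, a & q i j]) ->
  \sum_s slot_weight s * Q s = a * \sum_i \sum_j upper (w x) i j * q i j.
Proof.
move=> Qx; transitivity (\sum_y \sum_p slot_weight (y, p) * Q (y, p)).
  by rewrite pair_bigA; apply: eq_bigr => -[].
rewrite (bigD1 x) //= [X in _ + X]big1 ?addn0 => [|y /negPf yx]; last first.
  by apply: big1 => -[i j] _; rewrite Qx yx muln0.
rewrite pair_bigA big_distrr; apply: eq_bigr => -[i j] _ /=.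
by rewrite Qx eqxx; case: a {Qx} => /=; rewrite ?mul1n ?mul0n ?muln0.
Qed.

Lemma degree_attach_sub K A x i :
  degree (attach_sub K A) (x, i) =
  (i == i0) * degree K x + (x \in A) * \sum_j w x i j.
Proof.
rewrite /degree (@card_sum_tagged _ _ _ _
  (fun s => (s.1 \in A) && ((x, i) \in slot_ends s))); last first.
  by move=> e; rewrite inE.
congr (_ + _).
  have [->|ii0] := eqVneq i i0; last first.
    apply/eqP; rewrite mul0n cards_eq0; apply/eqP/setP => e; rewrite !inE.
    apply/negP => /andP[_ /imsetP[y _ [_ ii]]].
    by rewrite ii eqxx in ii0.
  rewrite mul1n; apply: eq_card => e; rewrite !inE.
  by rewrite (mem_imset _ _ base_inj).
rewrite (@sum_slots x (x \in A) (fun j k => (i == j) || (i == k))) => [|y j k].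
  by rewrite sum_upper_incident.
rewrite !inE !xpair_eqE (eq_sym y); case: eqVneq => [<-|_] //=.
by rewrite andbF.
Qed.

Lemma mult_attach_sub K A x i y j :
  mult (attach_sub K A) (x, i) (y, j) =
  [&& i == i0 & j == i0] * mult K x y + (x == y) * (x \in A) * w x i j.
Proof.
rewrite /mult (@card_sum_tagged _ _ _ _
  (fun s => (s.1 \in A) && (slot_ends s == [set (x, i); (y, j)]))); last first.
  by move=> e; rewrite inE.
congr (_ + _).
  have [/andP[/eqP-> /eqP->]|ij] := boolP (_ && _).
    rewrite mul1n; apply: eq_card => e; rewrite !inE /=.
    have -> : [set (x, i0); (y, i0)] = base @: [set x; y].
      by rewrite imsetU1 imset_set1.
    by rewrite (inj_eq (imset_inj base_inj)).
  rewrite mul0n; apply/eqP; rewrite cards_eq0; apply/eqP/setP => e.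
  rewrite !inE.
  apply: contraNF ij => /andP[_ /eqP exy].
  have {}exy : base @: ends e = [set (x, i); (y, j)] := exy.
  have /imsetP[? _ [_ ->]] : (x, i) \in base @: ends e by rewrite exy set21.
  have /imsetP[? _ [_ ->]] : (y, j) \in base @: ends e by rewrite exy set22.
  by rewrite eqxx.
rewrite (@sum_slots x ((x == y) && (x \in A))
  (fun k l => [set k; l] == [set i; j])) => [|z k l].
  by rewrite sum_upper_pair // mulnb.
have slot_image z' : [set (z', k); (z', l)] = pair z' @: [set k; l].
  by rewrite imsetU1 imset_set1.
have pair_inj z' : injective (pair z' : I -> vert H * I) by move=> ? ? [].
(* Both ends of a slot lie in one gadget, so [x = y = z]; injectivity of [pair z] then leaves an
   equality of index pairs. *)
apply/andP/idP => [[zA /eqP eq_ends]|/and3P[/eqP-> /andP[/eqP<- xA] /eqP kl]].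
  have xz : x = z.
    have : (x, i) \in slot_ends (z, (k, l)) by rewrite eq_ends set21.
    by rewrite !inE => /orP[]/eqP[].
  have yz : y = z.
    have : (y, j) \in slot_ends (z, (k, l)) by rewrite eq_ends set22.
    by rewrite !inE => /orP[]/eqP[].
  rewrite xz yz !eqxx zA /= -(inj_eq (imset_inj (@pair_inj z))) -slot_image.
  rewrite imsetU1 imset_set1; apply/eqP.
  by rewrite -[LHS]/(slot_ends (z, (k, l))) eq_ends xz yz.
by rewrite /slot_ends /= slot_image kl imsetU1 imset_set1.
Qed.

Lemma degree_attach x i :
  degree (whole attach) (x, i) =
  (i == i0) * degree (whole H) x + \sum_j w x i j.
Proof.
by rewrite /degree edges_attach_whole [LHS]degree_attach_sub inE mul1n.
Qed.

Lemma mult_attach x i y j :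
  mult (whole attach) (x, i) (y, j) =
  [&& i == i0 & j == i0] * mult (whole H) x y + (x == y) * w x i j.
Proof.
by rewrite /mult edges_attach_whole [LHS]mult_attach_sub in_setT muln1.
Qed.

Lemma isomorphic_to_attach (t : nat) :
  (forall v : vert attach,
     (Delta attach + t < degree (whole attach) v + max_mult (whole attach) v) =
     (v.2 == i0)) ->
  isomorphic_to H (core attach t).
Proof.
move=> coreE; have mem_core v : (v \in verts (core attach t)) = (v.2 == i0).
  by rewrite inE coreE.
exists base, (inl : edge H -> edge attach); split=> //.
- exact: base_inj.
- by move=> e f [].
- apply/setP => -[x i]; rewrite mem_core /=.
  apply/imsetP/eqP => [[y _ [_ ->]]|->] //.
  by exists x; rewrite ?inE.
apply/setP => e; rewrite inE; apply/imsetP/subsetP => [[f _ ->] v|].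
  by case/imsetP=> x _ ->; rewrite -/(verts (core attach t)) mem_core.
(* A gadget edge inside the core would have both ends at index [i0], in a slot of weight 0. *)
case: e => [e|[[x [i j]] k]] sub; first by exists e; rewrite ?inE.
have /eqP /= ii0 : (x, i).2 == i0 by rewrite -mem_core sub // set21.
have /eqP /= jj0 : (x, j).2 == i0 by rewrite -mem_core sub // set22.
have /eqP : slot_weight (x, (i, j)) = 0.
  by rewrite /slot_weight /= ii0 jj0 upper_eq0.
by rewrite -leqn0 leqNgt (leq_ltn_trans _ (ltn_ord k)).
Qed.

End Attach.

(** * The gadget on four vertices *)

Section Gadget.
Variables q s : nat.
Hypothesis sq : 4 * s <= q.

(* The degree [6 q - s] of vertex [0] completes [s - t] to [D = 6 q - t].  The
   other vertices have [degree i + gadget i 0 = D + t], the largest value that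
   keeps them out of the [t]-core; they then contribute [0] to the sums defining
   the fan-degrees at vertex [0]. *)
Definition gadget (i j : 'I_4) : nat :=
  nth 0 (nth [::] [:: [:: 0; 2 * q; 2 * q; 2 * q - s];
                      [:: 2 * q; 0; q - s; q + s];
                      [:: 2 * q; q - s; 0; q + s];
                      [:: 2 * q - s; q + s; q + s; 0]] i) j.

Lemma gadgetC i j : gadget i j = gadget j i.
Proof. by move: i j => [[|[|[|[]]]] //= ?] [[|[|[|[]]]] //= ?]. Qed.

Lemma gadget_diag i : gadget i i = 0.
Proof. by move: i => [[|[|[|[]]]]]. Qed.

Lemma gadget_degree0 : \sum_j gadget ord0 j = 6 * q - s.
Proof. rewrite !big_ord_recl big_ord0 /gadget /=; lia. Qed.

Lemma gadget_degree i : i != ord0 -> \sum_j gadget i j + gadget i ord0 = 6 * q.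
Proof.
rewrite !big_ord_recl big_ord0.
move: i => [[|[|[|[|//]]]] ?] //= _; rewrite /gadget /=; lia.
Qed.

Lemma gadget_max i j : i != ord0 -> gadget i j <= gadget i ord0.
Proof.
move: i j => [[|[|[|[|//]]]] ?] [[|[|[|[|//]]]] ?] //= _;
  rewrite /gadget /=; lia.
Qed.

(** The lower bound puts vertex [0] in the core and keeps the other degrees below [D]; the upper
    bound keeps those degrees large, so that the first alternative of the fan-degree fails. *)
Lemma gadget_base i : i != ord0 -> 2 * q - s <= gadget i ord0 <= 2 * q.
Proof. move: i => [[|[|[|[|//]]]] ?] //= _; rewrite /gadget /=; lia. Qed.

Lemma gadget_lift i j : i != ord0 -> j != ord0 -> gadget i j <= q + s.
Proof.
move: i j => [[|[|[|[|//]]]] ?] [[|[|[|[|//]]]] ?] //= _ _;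
  rewrite /gadget /=; lia.
Qed.

Lemma gadget_gt0 i j : 0 < q -> i != j -> 0 < gadget i j.
Proof.
move: i j => [[|[|[|[|//]]]] ?] [[|[|[|[|//]]]] ?] //= q0 _;
  rewrite /gadget /=; lia.
Qed.

Lemma gadget_triangle i j : i != ord0 -> j != ord0 -> i != j ->
  q - s + gadget j ord0 <= gadget i ord0 + gadget i j.
Proof.
move: i j => [[|[|[|[|//]]]] ?] [[|[|[|[|//]]]] ?] //= _ _ _;
  rewrite /gadget /=; lia.
Qed.

End Gadget.

(** * Maximum degree and core of the extension *)

Section CoreExtension.
Variables (H : mgraph) (t q : nat).
Hypothesis q_large : 4 * (t + #|edge H|) + 1 < q.

Definition slack (x : vert H) : nat := t + degree (whole H) x.
Definition weight (x : vert H) : 'I_4 -> 'I_4 -> nat := gadget q (slack x).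

Definition core_extension : mgraph := attach ord0 weight.
Local Notation G := core_extension.

Let wC x (i j : 'I_4) : weight x i j = weight x j i. Proof. exact: gadgetC. Qed.
Let w0 x (i : 'I_4) : weight x i i = 0. Proof. exact: gadget_diag. Qed.

Let s_lt x : 4 * slack x + 1 < q.
Proof.
apply: leq_ltn_trans q_large.
by rewrite leq_add2r leq_mul2l leq_add2l degree_leq_card_edge.
Qed.

Let s_small x : 4 * slack x <= q.
Proof. by apply: leq_trans (ltnW (s_lt x)); apply: leq_addr. Qed.

Let t_leq x : t <= slack x. Proof. exact: leq_addr. Qed.

Lemma degree_core_extension_base x :
  degree (whole G) (x, ord0) = 6 * q - t.
Proof.
rewrite degree_attach // gadget_degree0 // mul1n.
rewrite /slack; have := s_lt x; rewrite /slack; lia.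
Qed.

Lemma degree_core_extension_lift x (i : 'I_4) : i != ord0 ->
  degree (whole G) (x, i) + weight x i ord0 = 6 * q.
Proof.
by move=> i0; rewrite degree_attach // (negPf i0) /= add0n gadget_degree.
Qed.

(** The maximum is reached at vertices of [H], and [x] provides one; if [H] were empty, [Delta G]
    would be 0. *)
Lemma Delta_core_extension (x : vert H) : Delta G + t = 6 * q.
Proof.
suff -> : Delta G = 6 * q - t by have := s_lt x; rewrite /slack; lia.
apply/eqP; rewrite eqn_leq; apply/andP; split; last first.
  rewrite -(degree_core_extension_base x).
  by apply: (leq_bigmax_cond (F := degree (whole G))); rewrite inE.
apply/bigmax_leqP => -[y i] _.
have [->|i0] := eqVneq i ord0; first by rewrite degree_core_extension_base.
have := degree_core_extension_lift y i0.
have /andP[] := gadget_base (s_small y) i0; rewrite -/(weight y i ord0).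
have := s_lt y; have := t_leq y; move: (degree _ _) => d; lia.
Qed.

Lemma core_core_extension (x0 : vert H) : isomorphic_to H (core G t).
Proof.
apply: isomorphic_to_attach => -[x i]; rewrite Delta_core_extension //=.
have [->|i0] := eqVneq i ord0.
  have i1 : lift ord0 ord0 != ord0 :> 'I_4 by [].
  (* A single gadget neighbour already has multiplicity above [t], which lifts [6 q - t] above
     [6 q]. *)
  have : weight x ord0 (lift ord0 ord0) <= max_mult (whole G) (x, ord0).
    have <- : mult (whole G) (x, ord0) (x, lift ord0 ord0)
              = weight x ord0 (lift ord0 ord0).
      by rewrite mult_attach // (negPf i1) andbF eqxx mul1n.
    by apply: (leq_bigmax_cond (F := mult (whole G) (x, ord0))); rewrite inE.
  have /andP[] := gadget_base (s_small x) i1; rewrite gadgetC -/(weight _ _ _).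
  rewrite degree_core_extension_base; have := s_lt x; have := t_leq x.
  move: (weight x _ _) (max_mult _ _) => m n; lia.
(* The largest multiplicity at a gadget vertex is the one towards index 0, so its sum is at most
   [6 q], and the core asks for a strict inequality. *)
apply/negbTE; rewrite -leqNgt -(degree_core_extension_lift x i0) leq_add2l.
apply/bigmax_leqP => -[y j] _; rewrite mult_attach // (negPf i0) /= add0n.
by case: eqVneq => _; rewrite ?mul1n ?gadget_max.
Qed.

(** * The lower bound on the fan number *)

Section FanLowerBound.
Variable K : subgraph H.

(** A vertex isolated in [K] has no set [Z] to serve the pairs leading into its gadget, so that
    gadget is left out of [J]. *)
Let A := [set x | neighbours K x != set0].
Let J : subgraph G := attach_sub ord0 weight K A.

Let neighboursC x y : y \in neighbours K x -> x \in neighbours K y.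
Proof. by rewrite !inE multC. Qed.

Let active x y : y \in neighbours K x -> x \in A.
Proof. by move=> xy; rewrite inE; apply/set0Pn; exists y. Qed.

Let degree_base x : x \in A ->
  degree J (x, ord0) + slack x = degree K x + 6 * q.
Proof.
move=> xA; rewrite degree_attach_sub // xA eqxx !mul1n gadget_degree0 //.
have := s_small x; lia.
Qed.

Let degree_lift x (i : 'I_4) : x \in A -> i != ord0 ->
  degree J (x, i) + weight x i ord0 = 6 * q.
Proof.
by move=> xA i0; rewrite degree_attach_sub // xA (negPf i0) mul1n add0n
  gadget_degree.
Qed.

Let mult_base x y : mult J (x, ord0) (y, ord0) = mult K x y.
Proof. by rewrite mult_attach_sub // mul1n w0 muln0 addn0. Qed.

Let mult_slot x (i j : 'I_4) : x \in A -> mult J (x, i) (x, j) = weight x i j.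
Proof.
move=> xA; rewrite mult_attach_sub // xA eqxx !mul1n.
suff -> : mult K x x = 0 by rewrite muln0.
by apply/eqP; rewrite -leqn0 leqNgt; apply/negP => /mult_gt0_neq/eqP.
Qed.

Lemma fan_deg_base x (j : 'I_4) (Z : {set vert H}) (v : vert G) :
  j != ord0 -> Z \subset neighbours K x -> Z != set0 ->
  (2 <= \sum_(z in Z) ((degree K z)%:Z - (degree (whole H) z)%:Z
                        + (mult K x z)%:Z - t%:Z))%R ->
  v \in (x, j) |: [set (z, ord0) | z in Z] ->
  6 * q < fan_deg J (x, ord0) v.
Proof.
move=> j0 /subsetP sZ /set0Pn[y yZ] sumZ vZ.
have xA : x \in A by apply/active/sZ/yZ.
have ZA z : z \in Z -> z \in A by move/sZ/neighboursC/active.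
have base0 := @base_inj H 'I_4 ord0.
have xjZ : (x, j) \notin [set (z, ord0) | z in Z].
  by apply/imsetP => -[z _ [_ jj]]; rewrite jj eqxx in j0.
apply: (@fan_deg_gt G J _ v _ ((x, j) |: [set (z, ord0) | z in Z]) _ _ vZ).
- have := degree_base xA; have := s_lt x; have := t_leq x.
  move: vZ; rewrite in_setU1 => /predU1P[->|/imsetP[z zZ ->]].
    rewrite mult_slot //; have := degree_lift xA j0.
    have /andP[] := gadget_base (s_small x) j0; rewrite gadgetC.
    rewrite -!/(weight _ _ _) [weight x j _]wC; lia.
  (* Both degrees are at least [6 q] minus a slack, while the slacks and the multiplicity are each
     below [q / 4]. *)
  rewrite mult_base; have := degree_base (ZA z zZ); have := s_lt z.
  have := leq_trans (mult_leq_card_edge K x z) (leq_addl t _).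
  move: q_large; lia.
- apply/subsetP => v'; rewrite in_setU1 inE => /predU1P[->|/imsetP[z zZ ->]].
    rewrite mult_slot // gadget_gt0 //; last by rewrite eq_sym.
    exact: leq_ltn_trans q_large.
  by rewrite mult_base; have := sZ z zZ; rewrite inE.
- rewrite cardsU1 xjZ card_imset //; apply/card_gt0P.
  by exists y.
rewrite big_setU1 //= big_imset /=; last by move=> z z' _ _ /base0.
(* The vertex [(x, j)] contributes 0, and the term at [z] is unchanged since
   [d_J z - 6 q = d_K z - d_H z - t]. *)
apply: le_trans sumZ _; rewrite -[leLHS]add0r; apply: lerD.
  have := degree_lift xA j0; rewrite mult_slot // [weight x ord0 j]wC; lia.
apply: ler_sum => z zZ; rewrite mult_base.
have := degree_base (ZA z zZ); rewrite /slack; lia.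
Qed.

Lemma fan_deg_lift x (i j : 'I_4) (v : vert G) :
  x \in A -> i != ord0 -> j != ord0 -> i != j ->
  v \in [set (x, ord0); (x, j)] -> 6 * q < fan_deg J (x, i) v.
Proof.
move=> xA i0 j0 ij vZ.
have /andP[wi1 wi2] := gadget_base (s_small x) i0.
have /andP[wj1 wj2] := gadget_base (s_small x) j0.
have wij := gadget_triangle (s_small x) i0 j0 ij.
have wl := gadget_lift (s_small x) i0 j0.
have dx := degree_base xA.
have di := degree_lift xA i0.
have dj := degree_lift xA j0.
have sx := s_lt x.
have tx := t_leq x.
rewrite -!/(weight _ _ _) in wi1 wi2 wj1 wj2 wij wl.
apply: (@fan_deg_gt G J _ v _ [set (x, ord0); (x, j)] _ _ vZ).
(* Both degrees are at least [4 q]. Towards [j], [gadget_lift] leaves at least [7 q - slack x];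
   towards the base, its larger degree leaves at least [8 q - slack x]. *)
- by move: vZ; rewrite !inE => /pred2P[]->; rewrite mult_slot //; lia.
- apply/subsetP => v'; rewrite !inE => /pred2P[]->; rewrite mult_slot //;
    by apply: gadget_gt0; rewrite //; exact: leq_ltn_trans q_large.
- by rewrite cards2 xpair_eqE eqxx eq_sym j0.
rewrite big_setU1 /=; last by rewrite inE xpair_eqE eqxx eq_sym.
(* The sum is [d_K x - slack x + w i 0 + w i j - w j 0], which [gadget_triangle] bounds below by
   [q - 2 * slack x], at least 2. *)
rewrite big_set1 !mult_slot //; lia.
Qed.

Lemma Fan_core_extension : edges K != set0 ->
  (forall x y, 0 < mult K x y -> t < cfan_deg K x y) -> 6 * q < Fan G.
Proof.
move=> K0 ltK; have [x1 [y1 xy1]] := exists_mult_gt0 K0.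
have J1 : 0 < mult J (x1, ord0) (y1, ord0) by rewrite mult_base.
rewrite leq_max; apply/orP; right.
apply: (@leq_trans (min_over_edges J (fan_deg J))); last first.
  apply: (leq_bigmax_cond (F := fun L => min_over_edges L (fan_deg L))).
  exact: mult_gt0_edges J1.
apply: min_over_edges_gt; first by exists (x1, ord0), (y1, ord0).
(* For a pair inside [K] any gadget vertex can enlarge [Z]; this one is used. *)
have l0 : lift ord0 ord0 != ord0 :> 'I_4 by [].
move=> [x i] [y j].
have [->|i0] := eqVneq i ord0; have [->|j0] := eqVneq j ord0.
- rewrite mult_base => /ltK/cfan_deg_gt[Z [sZ yZ sumZ]].
  apply: (fan_deg_base l0 sZ) sumZ _; first by apply/set0Pn; exists y.
  by rewrite in_setU1 imset_f ?orbT.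
- rewrite mult_attach_sub // (negPf j0) add0n !muln_gt0 !lt0b -andbA.
  (* Membership in [A] supplies an edge of [K] at [x], whose set [Z] also serves the pair leading
     into the gadget. *)
  case/and3P=> /eqP <-; rewrite inE => /set0Pn[y']; rewrite inE.
  move=> /ltK/cfan_deg_gt[Z [sZ yZ sumZ]] _.
  apply: (fan_deg_base j0 sZ) sumZ _; first by apply/set0Pn; exists y'.
  exact: setU11.
- rewrite mult_attach_sub // (negPf i0) add0n !muln_gt0 !lt0b -andbA.
  case/and3P=> /eqP <- xA _.
  (* The pair leads back to the base, so a second gadget vertex is chosen to complete the
     two-element set. *)
  have [k k0 ik] : exists2 k : 'I_4, k != ord0 & i != k.
    have [->|il] := eqVneq i (lift ord0 ord0); first by exists ord_max.
    by exists (lift ord0 ord0).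
  by apply: fan_deg_lift ik _; rewrite ?set21.
rewrite mult_attach_sub // (negPf i0) add0n !muln_gt0 !lt0b -andbA.
case/and3P=> /eqP <- xA wij.
have ij : i != j by apply: contraTneq wij => ->; rewrite w0.
by apply: fan_deg_lift ij _; rewrite ?set22.
Qed.

End FanLowerBound.

End CoreExtension.

Theorem theorem1p8 (H : mgraph) (t : nat) :
  t < cfan H ->
  exists G : mgraph, isomorphic_to H (core G t) /\ Delta G + t < Fan G.
Proof.
(* An edge of [K] yields the vertex of [H] required by [Delta_core_extension]; [q] is then the least
   admissible value. *)
move=> /cfan_gt[K [K0 ltK]]; have [x _] := exists_mult_gt0 K0.
have q_large := ltnSn (4 * (t + #|edge H|) + 1).
exists (core_extension H t (4 * (t + #|edge H|) + 1).+1); split.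
  exact: core_core_extension.
by rewrite Delta_core_extension //; apply: Fan_core_extension ltK.
Qed.
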